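(* Let $\Sigma$ be a finite alphabet with at least two letters, let $n\ge 2$ and $1\le k\le n-1$ be integers, let $(L_i,R_i)_{i\in\{1,\dots,k\}}$ be an admissible family, and let $C\subseteq\Sigma^n$ be its associated code (all sets occurring in the definition of $C$ being defined; see the context). Consider the condition (P) for all $1\le t\le k$, every $x\in L_t$ is a prefix in $C$ and every $x\in R_t$ is a suffix in $C$. If (P) holds, then $C$ is a maximal $(1,k)$-overlap-free code. If $|L_{n/2}\cup R_{n/2}|>1$ (a requirement that concerns only the index $t=n/2$, so that nothing is required when $n$ is odd), the reverse also holds: if $C$ is a maximal $(1,k)$-overlap-free code, then (P) holds.
   Context: For sets of words $L,R$, $LR$ denotes the set of all concatenations $lr$ with $l\in L$, $r\in R$. A composition of a positive integer $m$ is a tuple $\alpha=(\alpha_1,\dots,\alpha_p)$ of positive integers with sum $m$; $\mathrm{par}(\alpha)=p$ is its number of parts; the only composition of $0$ is the empty one, with $\mathrm{par}=0$. A word $x$ is a prefix (suffix) in $C$ if some codeword of $C$ begins (ends) with $x$. Two (not necessarily distinct) words $u,v$ have a $t$-overlap if the prefix of $u$ of length $t$ equals the suffix of $v$ of length $t$, or vice versa. A code $C\subseteq\Sigma^n$ is $(1,k)$-overlap-free if for all $1\le t\le k$ no two (not necessarily distinct) codewords have a $t$-overlap. A $(1,k)$-overlap-free code $C\subseteq\Sigma^n$ is maximal if for every $w\in\Sigma^n\setminus C$ the code $C\cup\{w\}$ is not $(1,k)$-overlap-free. A family $(L_i,R_i)_{i\in\{1,\dots,k\}}$ is admissible if $(L_1,R_1)$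 is a partition of $\Sigma$ into two non-empty parts and, for every $i\in\{2,\dots,k\}$, $(L_i,R_i)$ is a partition of $\bigcup_{j=1}^{i-1}L_jR_{i-j}$ into two disjoint, possibly empty, parts. The associated code, which is $(1,k)$-overlap-free, is $$C=\bigcup_{s=k+1}^{n}\ \bigcup_{j=s-k}^{k}\ \bigcup_{\alpha}\ \bigcup_{i=0}^{\mathrm{par}(\alpha)} L_{\alpha_1}\cdots L_{\alpha_i}\,L_jR_{s-j}\,R_{\alpha_{i+1}}\cdots R_{\alpha_{\mathrm{par}(\alpha)}}\subseteq\Sigma^n,$$ where $\alpha$ ranges over all compositions of $n-s$. Since $L_i,R_i$ are given only for $i\le k$, and the composition of $n-k-1$ with a single part occurs, all sets in this formula are defined exactly when $n-k-1\le k$, i.e. $n\le 2k+1$. *)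

(* Defs.v *)
From mathcomp Require Export all_boot.
From mathcomp Require Export boolp classical_sets functions cardinality.

Set Implicit Arguments.
Unset Strict Implicit.
Unset Printing Implicit Defensive.

Local Open Scope classical_set_scope.

Section Codes.
Variable Sigma : finType.
Implicit Types (C : set (seq Sigma)) (L R : nat -> set (seq Sigma)).

Definition words (n : nat) : set (seq Sigma) := [set w | size w = n].

Definition concat (A B : set (seq Sigma)) : set (seq Sigma) :=
  [set x ++ y | x in A & y in B].

Definition prefix_in C (x : seq Sigma) : Prop := exists2 c, C c & prefix x c.
Definition suffix_in C (x : seq Sigma) : Prop := exists2 c, C c & suffix x c.

(* The bounds on t make [take t u] and [drop (size v - t) v] the prefix and
   the suffix of length exactly t. *)
Definition overlap (t : nat) (u v : seq Sigma) : Prop :=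
  [/\ t <= size u, t <= size v &
      take t u = drop (size v - t) v \/ take t v = drop (size u - t) u].

Definition overlap_free (n k : nat) C : Prop :=
  C `<=` words n /\
  forall t, 1 <= t <= k -> forall u v, C u -> C v -> ~ overlap t u v.

Definition maximal_overlap_free (n k : nat) C : Prop :=
  overlap_free n k C /\
  forall w, words n w -> ~ C w -> ~ overlap_free n k (C `|` [set w]).

(* Only the indices 1, ..., k of L and R are meaningful. *)
Definition admissible (k : nat) L R : Prop :=
  [/\ L 1 `|` R 1 = words 1, [disjoint L 1 & R 1], L 1 !=set0, R 1 !=set0 &
      forall i, 2 <= i <= k ->
        L i `|` R i =
          \bigcup_(j in [set j | 1 <= j <= i - 1]) concat (L j) (R (i - j))
        /\ [disjoint L i & R i]].

Definition composition (m : nat) (al : seq nat) : Prop :=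
  all (leq 1) al /\ sumn al = m.

Definition concats (F : nat -> set (seq Sigma)) (al : seq nat) :
    set (seq Sigma) :=
  \big[concat/[set [::]]]_(a <- al) F a.

(* When k < n <= 2 * k + 1, only the indices 1, ..., k of L and R are used. *)
Definition associated_code (n k : nat) L R : set (seq Sigma) :=
  \bigcup_(s in [set s | k + 1 <= s <= n])
  \bigcup_(j in [set j | s - k <= j <= k])
  \bigcup_(al in composition (n - s))
  \bigcup_(i in [set i | 0 <= i <= size al])
    concat (concats L (take i al))
      (concat (concat (L j) (R (s - j))) (concats R (drop i al))).

Definition prefix_suffix_condition (k : nat) L R C : Prop :=
  forall t, 1 <= t <= k ->
    (forall x, L t x -> prefix_in C x) /\ (forall x, R t x -> suffix_in C x).

End Codes.

(* Main.v *)
Require Import Defs.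
From mathcomp Require Import zify.

Set Implicit Arguments.
Unset Strict Implicit.
Unset Printing Implicit Defensive.

(* Call the words of the L_i and R_i blocks. Merging adjacent blocks l r (l left,
   r right) as long as the result is short rewrites every word of length at most
   2k+1 into R^* L^* or R^* L^* b R^* L^*, where b is a product l r longer than
   k, and C consists of the words L^* b R^*. Parsing with a stack shows that L^+
   and R^+ are disjoint; as the prefixes (suffixes) of length at most k of
   codewords lie in L^+ (R^+), C is overlap-free. Under (P), a word that starts
   with a right block or ends with a left block overlaps a codeword, and the
   remaining words are in C.
   Conversely, let x be a left block which is not a prefix in C. If u is a left
   block, or a word b R^*, of length n - |x|, then every suffix of ux of length at
   most k is in R^*, or in R^* x, and the latter meets L^+ only in x. So ux can
   be added to C unless x is a prefix of ux, and this exception is avoided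
   by the choice of u (where |L_{n/2} u R_{n/2}| > 1 is needed when |x| = n/2) or
   reduced to a longer left block. Right blocks follow by reversing all words. *)

Local Open Scope classical_set_scope.
Local Open Scope card_scope.

Section Blocks.
Variable T : finType.
Implicit Types (x y z u v w p q c d : seq T) (lp rp : pred (seq T)).

(** * Concatenations of words from a set, and overlaps *)

Definition star (P : pred (seq T)) x := exists2 s, all P s & x = flatten s.

Lemma star_nil (P : pred (seq T)) : star P [::].
Proof. by exists [::]. Qed.

Lemma star_block (P : pred (seq T)) x : P x -> star P x.
Proof. by move=> Px; exists [:: x]; rewrite /= ?Px ?cats0. Qed.

Lemma star_cat (P : pred (seq T)) x y : star P x -> star P y -> star P (x ++ y).
Proof.
move=> [s Ps ->] [s' Ps' ->]; exists (s ++ s'); last by rewrite flatten_cat.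
by rewrite all_cat Ps.
Qed.

Lemma star_rev (P : pred (seq T)) x : star P x -> star (preim rev P) (rev x).
Proof.
move=> [s Ps ->]; exists (rev (map rev s)); last exact: rev_flatten.
rewrite all_rev all_map; apply: sub_all Ps => y Py /=.
by rewrite revK.
Qed.

(** Repeating a letter pads words to any prescribed length. *)
Lemma star_of_size (P : pred (seq T)) a m :
  P a -> size a = 1 -> exists2 x, star P x & size x = m.
Proof.
move=> Pa a1; elim: m => [|m [x Sx xm]]; first by exists [::]; first exact: star_nil.
exists (a ++ x); first exact: star_cat (star_block Pa) Sx.
by rewrite size_cat a1 xm.
Qed.

Lemma prefix_catP p x y :
  prefix p (x ++ y) ->
  prefix p x \/ exists2 q, p = x ++ q & prefix q y.
Proof.
rewrite prefixE take_cat; case: ltnP => [_ | _ /eqP<-].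
  by rewrite -prefixE; left.
by right; exists (take (size p - size x) y); rewrite ?prefix_take.
Qed.

Lemma prefix_size_eq p x : prefix p x -> size p = size x -> p = x.
Proof.
case/prefixP=> z ->; rewrite size_cat => /eqP; rewrite -{1}[size p]addn0.
by rewrite eqn_add2l eq_sym size_eq0 => /eqP->; rewrite cats0.
Qed.

(** The common word [p] replaces the length [t]. One of the two alternatives in [overlap] suffices,
    since [c] and [d] run over all ordered pairs of codewords. *)
Lemma overlap_freeP n k (D : set (seq T)) :
  overlap_free n k D <->
  D `<=` words n /\
  forall p c d, 0 < size p <= k -> D c -> D d -> prefix p c -> suffix p d -> False.
Proof.
split=> -[Dn ov]; split=> //.
  move=> p c d p0 Dc Dd pc pd.
  apply: (ov (size p) p0 c d Dc Dd).
  split; [exact: size_prefix|exact: size_suffix|left].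
  case/prefixP: pc => z ->; case/suffixP: pd => z' ->.
  by rewrite take_size_cat // size_cat addnK drop_size_cat.
move=> t t0k; suff ov' c d : D c -> D d -> t <= size c -> t <= size d ->
    take t c = drop (size d - t) d -> False.
  by move=> c d Dc Dd [tc td [|]]; [exact: ov'|exact: ov'].
move=> Dc Dd tc td E; apply: (ov (take t c) c d _ Dc Dd).
- by rewrite size_takel.
- exact: prefix_take.
- by rewrite E; exact: suffix_drop.
Qed.

(** * Block families and their symmetry under reversal *)

(** What the proof uses of an admissible family, with the index of a set replaced by the length of
    its words. [block_merge] and [block_split] are the two inclusions in the recursive equation. *)
Record block_family k lp rp : Prop := BlockFamily {
  block_disjoint : forall x, lp x -> ~~ rp x;
  block_size : forall x, lp x || rp x -> 0 < size x <= k;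
  block_letter : forall x, size x = 1 -> lp x || rp x;
  block_merge : forall x y, lp x -> rp y -> size (x ++ y) <= k ->
    lp (x ++ y) || rp (x ++ y);
  block_split : forall x, lp x || rp x ->
    size x = 1 \/ exists y z, [/\ lp y, rp z & x = y ++ z];
  block_left : exists2 x, lp x & size x = 1;
  block_right : exists2 x, rp x & size x = 1 }.

Definition big_block k lp rp x :=
  k < size x /\ exists y z, [/\ lp y, rp z & x = y ++ z].

Definition block_code n k lp rp : set (seq T) := [set c | size c = n /\
  exists u b v, [/\ star lp u, big_block k lp rp b, star rp v & c = u ++ b ++ v]].

(** Reversal turns [l ++ r] around, so the two sides swap roles. This transfers results on prefixes
    and left blocks to suffixes and right blocks. *)
Lemma block_family_rev k lp rp :
  block_family k lp rp -> block_family k (preim rev rp) (preim rev lp).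
Proof.
case=> disj sz let1 mrg spl [l ll l1] [r rr r1]; split=> /=.
- by move=> x rx; apply/negP => /disj; rewrite rx.
- by move=> x; rewrite orbC => /sz; rewrite size_rev.
- by move=> x x1; rewrite orbC let1 ?size_rev.
- move=> x y rx ly; rewrite rev_cat orbC => s; apply: mrg => //.
  by rewrite size_cat !size_rev addnC -size_cat.
- move=> x; rewrite orbC => /spl[|[y [z [ly rz E]]]]; first by left; rewrite -size_rev.
  right; exists (rev z), (rev y); rewrite !revK; split=> //.
  by rewrite -rev_cat -E revK.
- by exists (rev r); rewrite ?size_rev ?revK.
- by exists (rev l); rewrite ?size_rev ?revK.
Qed.

Lemma big_block_rev k lp rp x :
  big_block k lp rp x -> big_block k (preim rev rp) (preim rev lp) (rev x).
Proof.
case=> kx [y [z [ly rz E]]]; split; first by rewrite size_rev.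
by exists (rev z), (rev y); rewrite /= !revK E rev_cat.
Qed.

Lemma block_code_rev n k lp rp c : block_code n k lp rp c ->
  block_code n k (preim rev rp) (preim rev lp) (rev c).
Proof.
case=> cn [u [b [v [su bb sv E]]]]; split; first by rewrite size_rev.
rewrite E; exists (rev v), (rev b), (rev u); split; last by rewrite !rev_cat catA.
- exact: star_rev.
- exact: big_block_rev.
- exact: star_rev.
Qed.

Lemma overlap_free_rev n k (D : set (seq T)) :
  overlap_free n k D -> overlap_free n k (rev @^-1` D).
Proof.
move=> /overlap_freeP[Dn ov]; apply/overlap_freeP; split.
  by move=> c /Dn; rewrite /words /= size_rev.
move=> p c d p0 Dc Dd pc pd; apply: (ov (rev p) (rev d) (rev c)) => //.
- by rewrite size_rev.
- by rewrite suffix_rev.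
Qed.


(** * Parsing with a stack: left words against right words *)

Section Family.
Variables (n k : nat) (lp rp : pred (seq T)).
Hypothesis F : block_family k lp rp.

Lemma left_right_false x : lp x -> rp x -> False.
Proof. by move=> /(block_disjoint F)/negP. Qed.

(* The stack holds the blocks read so far, the most recent one first. *)
Fixpoint push (st : seq (seq T)) x :=
  if st is y :: st' then
    if lp y && rp x then push st' (y ++ x) else x :: st
  else [:: x].

Definition parse st x := foldl (fun st a => push st [:: a]) st x.

Lemma parse_cat st x y : parse st (x ++ y) = parse (parse st x) y.
Proof. exact: foldl_cat. Qed.

Lemma push_left st x : lp x -> push st x = x :: st.
Proof.
move=> lx; case: st => [|y st] //=.
by rewrite (negbTE (block_disjoint F lx)) andbF.
Qed.

(** For [x = y ++ z], induction pushes first [y], then [z]; as [y] lies on top, [z] merges with it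
    at once, and the result is pushed on [st]. *)
Lemma parse_block x st : lp x || rp x -> parse st x = push st x.
Proof.
have [m] := ubnP (size x); elim: m x st => // m IH x st xm bx.
case: (block_split F bx) => [|[y [z [ly rz E]]]].
  by case: x {xm bx} => [|a [|]].
have y0 : 0 < size y by case/andP: (block_size F (introT orP (or_introl ly))).
have z0 : 0 < size z by case/andP: (block_size F (introT orP (or_intror rz))).
move: xm; rewrite E size_cat => xm.
rewrite parse_cat (IH y) ?ly //; last lia.
by rewrite push_left // (IH z) ?rz ?orbT //= ?ly ?rz //; lia.
Qed.

Lemma parse_lefts s st : all lp s -> parse st (flatten s) = rev s ++ st.
Proof.
elim: s st => //= x s IH st /andP[lx ls].
rewrite parse_cat (@parse_block x) ?lx //.
by rewrite push_left // IH // rev_cons cat_rcons.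
Qed.

Lemma parse_rights s s' : all rp s -> all rp s' ->
  parse s' (flatten s) = rev s ++ s'.
Proof.
elim: s s' => //= x s IH s' /andP[rx rs] rs'.
rewrite parse_cat (@parse_block x) ?rx ?orbT //.
have -> : push s' x = x :: s'.
  case: s' rs' => //= y s' /andP[ry _]; rewrite rx andbT.
  by case: ifP => // /left_right_false/(_ ry).
by rewrite IH /= ?rx // rev_cons cat_rcons.
Qed.

(** The final stack depends only on the word. Read from [x ++ y], it contains the right blocks of
    [x]; read from the factorization of the whole word, it contains left blocks only. *)
Lemma star_rights_lefts x y : star rp x -> star lp y -> star lp (x ++ y) -> x = [::].
Proof.
move=> [s rs ->] [s1 ls1 ->] [s2 ls2] /(congr1 (parse [::])).
rewrite parse_cat (parse_rights rs) // !parse_lefts // !cats0.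
case: s rs => // r s /andP[rr _] /(congr1 (fun s' => r \in s')).
rewrite mem_cat !mem_rev in_cons eqxx orbT => /esym r2.
by case: (@left_right_false r); first exact: (allP ls2).
Qed.

Lemma star_disjoint x : star lp x -> star rp x -> x = [::].
Proof.
by move=> lx rx; apply: (star_rights_lefts rx (star_nil lp)); rewrite cats0.
Qed.

(** * Prefixes of blocks and of codewords *)

(** With [x = y ++ z], a proper prefix lies inside the left block [y] or is [y] followed by a proper
    prefix of [z]; properness keeps the right block [z] itself from being completed. *)
Lemma block_prefix p x :
  lp x || rp x -> prefix p x -> size p < size x -> star lp p.
Proof.
have [m] := ubnP (size x); elim: m x p => // m IH x p xm bx px sp.
case: (block_split F bx) => [x1|[y [z [ly rz E]]]].
  by case: p px sp => [|a p]; [exists [::]|rewrite x1].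
have y0 : 0 < size y by case/andP: (block_size F (introT orP (or_introl ly))).
have z0 : 0 < size z by case/andP: (block_size F (introT orP (or_intror rz))).
move: xm px sp; rewrite E size_cat => xm /prefix_catP[py|[q -> qz]] sp.
  have [sy|sy] := ltnP (size p) (size y); first by apply: (IH y) => //; rewrite ?ly //; lia.
  rewrite (prefix_size_eq py); first exact: star_block.
  by apply/eqP; rewrite eqn_leq sy size_prefix.
apply: star_cat (star_block ly) _.
by apply: (IH z); rewrite ?rz ?orbT //; move: sp; rewrite ?size_cat; lia.
Qed.

Lemma left_prefix p x : lp x -> prefix p x -> star lp p.
Proof.
move=> lx px; have := size_prefix px; rewrite leq_eqVlt => /orP[/eqP s|].
  by rewrite (prefix_size_eq px s); exact: star_block.
by apply: block_prefix px; rewrite lx.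
Qed.

Lemma star_prefix p x : star lp x -> prefix p x -> star lp p.
Proof.
move=> [s + ->]; elim: s p => [|y s IH] p.
  by move=> _; rewrite prefixs0 => /eqP->; exact: star_nil.
move=> /= /andP[ly ls] /prefix_catP[/(left_prefix ly) //|[q -> qs]].
exact: star_cat (star_block ly) (IH _ ls qs).
Qed.

Lemma big_prefix p x :
  big_block k lp rp x -> prefix p x -> size p < size x -> star lp p.
Proof.
move=> [_ [y [z [ly rz ->]]]] /prefix_catP[/(left_prefix ly) //|[q -> qz]].
rewrite !size_cat ltn_add2l => sq; apply: star_cat (star_block ly) _.
by apply: block_prefix qz sq; rewrite rz orbT.
Qed.

Lemma star_big_prefix p u b : star lp u -> big_block k lp rp b ->
  prefix p (u ++ b) -> size p < size (u ++ b) -> star lp p.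
Proof.
move=> su bb /prefix_catP[/(star_prefix su) //|[q -> qb]].
by rewrite !size_cat ltn_add2l => /(big_prefix bb qb); exact: star_cat.
Qed.

(** A prefix of length at most [k] stops before the end of the big block, which is longer than
    [k]. *)
Lemma code_prefix p c :
  block_code n k lp rp c -> prefix p c -> size p <= k -> star lp p.
Proof.
move=> [_ [u [b [v [su bb sv ->]]]]]; rewrite catA => pc pk.
have bk : k < size (u ++ b) by case: bb; rewrite size_cat; lia.
case: (prefix_catP pc) => [pub|[q E _]]; last by move: pk; rewrite E size_cat; lia.
by apply: star_big_prefix pub _ => //; lia.
Qed.

End Family.
Arguments star_disjoint {k lp rp} F {x}.

Lemma star_unrev (P : pred (seq T)) x : star (preim rev P) (rev x) -> star P x.
Proof.
move=> /star_rev; rewrite revK => -[s Ps ->]; exists s => //.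
by apply: sub_all Ps => y; rewrite /= revK.
Qed.

(** * Suffixes, by reversal, and overlap-freeness *)

Section FamilySuffix.
Variables (n k : nat) (lp rp : pred (seq T)).
Hypothesis F : block_family k lp rp.
Let F' := block_family_rev F.

Lemma block_suffix q x :
  lp x || rp x -> suffix q x -> size q < size x -> star rp q.
Proof.
move=> bx qx s; apply: star_unrev; apply: (block_prefix F' (x := rev x)).
- by rewrite /= !revK orbC.
- by rewrite prefix_rev.
- by rewrite !size_rev.
Qed.

Lemma big_star_suffix q b v : big_block k lp rp b -> star rp v ->
  suffix q (b ++ v) -> size q < size (b ++ v) -> star rp q.
Proof.
move=> bb sv qs s; apply: star_unrev.
apply: (star_big_prefix F' (star_rev sv) (big_block_rev bb)).
- by rewrite -rev_cat prefix_rev.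
- by rewrite -rev_cat !size_rev.
Qed.

Lemma code_suffix q c :
  block_code n k lp rp c -> suffix q c -> size q <= k -> star rp q.
Proof.
move=> cc qc qk; apply: star_unrev; apply: (code_prefix F' (block_code_rev cc)).
- by rewrite prefix_rev.
- by rewrite size_rev.
Qed.

Lemma block_code_overlap_free : overlap_free n k (block_code n k lp rp).
Proof.
apply/overlap_freeP; split=> [c []//|p c d /andP[p0 pk] cc dd pc pd].
have p1 := code_prefix F cc pc pk; have p2 := code_suffix dd pd pk.
by rewrite (star_disjoint F p1 p2) in p0.
Qed.

(** * Normal form of short words, and maximality under (P) *)

(* The words whose parse contains no big block. *)
Definition right_left x := exists u v, [/\ star rp u, star lp v & x = u ++ v].

(** The right block merges with the last left block again and again, until the merged block is a
    left one, no left block remains, or the product is too long to be a block. *)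
Lemma right_left_snoc x r : right_left x -> rp r -> right_left (x ++ r) \/
  exists y b, [/\ right_left y, big_block k lp rp b & x ++ r = y ++ b].
Proof.
move=> [u [v [su [s ls ->]] ->]].
elim/last_ind: s r ls => [|s l IH] r.
  move=> _ rr; left; exists (u ++ r), [::]; split.
  - exact: star_cat su (star_block rr).
  - exact: star_nil.
  - by rewrite !cats0.
rewrite all_rcons -cats1 flatten_cat /= cats0 => /andP[ll ls] rr.
have [lrk|lrk] := leqP (size (l ++ r)) k; last first.
  right; exists (u ++ flatten s), (l ++ r); split; last by rewrite !catA.
  - by exists u, (flatten s); split=> //; exists s.
  - by split=> //; exists l, r.
rewrite -!catA; case/orP: (block_merge F ll rr lrk) => lr.
  left; exists u, (flatten s ++ l ++ r); split=> //.
  by apply: star_cat (star_block lr); exists s.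
by have := IH _ ls lr; rewrite -!catA.
Qed.

Lemma right_left_parse w : size w <= 2 * k + 1 -> right_left w \/
  exists x b y, [/\ right_left x, big_block k lp rp b, right_left y & w = x ++ b ++ y].
Proof.
elim/last_ind: w => [_|w a IH].
  by left; exists [::], [::]; split=> //; exact: star_nil.
rewrite -cats1 => sw; have /IH {IH}IH : size w <= 2 * k + 1.
  by move: sw; rewrite size_cat; lia.
have := block_letter F (erefl : size [:: a] = 1) => /orP[la|ra].
  have snoc x : right_left x -> right_left (x ++ [:: a]).
    move=> [u [v [su sv ->]]]; exists u, (v ++ [:: a]); split=> //.
      exact: star_cat sv (star_block la).
    by rewrite catA.
  case: IH => [/snoc|[x [b [y [rx bb ry ->]]]]]; first by left.
  by right; exists x, b, (y ++ [:: a]); split=> //; [exact: snoc|rewrite -!catA].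
case: IH => [wr|[x [b [y [rx bb ry E]]]]].
  case: (right_left_snoc wr ra) => [|[y [b [ry bb E]]]]; first by left.
  right; exists y, b, [::]; rewrite cats0; split=> //.
  by exists [::], [::]; split=> //; exact: star_nil.
right; case: (right_left_snoc ry ra) => [rya|[z [b' [_ [bb' _] Ez]]]].
  by exists x, b, (y ++ [:: a]); split=> //; rewrite E -!catA.
(* Two big blocks would take at least [2 * k + 2] letters. *)
case: bb => bb _; have := congr1 size Ez.
by move: sw; rewrite E !size_cat; lia.
Qed.

Lemma block_code_maximal : k < n <= 2 * k + 1 ->
  (forall x, lp x -> prefix_in (block_code n k lp rp) x) ->
  (forall x, rp x -> suffix_in (block_code n k lp rp) x) ->
  maximal_overlap_free n k (block_code n k lp rp).
Proof.
move=> /andP[kn n2k] PL PR; split; first exact: block_code_overlap_free.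
move=> w wn nCw /overlap_freeP[_ ov]; apply: nCw.
(* By (P), a right block beginning [w] also ends a codeword, which is an overlap; dually for a left
   block ending [w]. *)
have noR r : rp r -> prefix r w -> False.
  move=> rr rw; have [c Cc cs] := PR r rr.
  by apply: (ov r w c) => //; [apply: (block_size F); rewrite rr orbT|right|left].
have noL l : lp l -> suffix l w -> False.
  move=> ll lw; have [c Cc cs] := PL l ll.
  by apply: (ov l c w) => //; [apply: (block_size F); rewrite ll|left|right].
have starR u v : star rp u -> w = u ++ v -> u = [::].
  move=> [[|r s] //= /andP[rr _] ->] E; case: (noR r rr).
  by rewrite E -catA prefix_prefix.
have starL u v : star lp v -> w = u ++ v -> v = [::].
  move=> [s + ->]; elim/last_ind: s => // s l _.
  rewrite all_rcons => /andP[ll _] E; case: (noL l ll).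
  by rewrite E -cats1 flatten_cat /= cats0 catA suffix_suffix.
(* The outer factors of the normal form are now empty: without a big block [w] would be empty, and
   with one it is a codeword. *)
case: (@right_left_parse w); first by rewrite wn.
  move=> [u [v [su sv E]]]; move: (wn); rewrite /words /= E.
  by rewrite (starR _ _ su E) (starL _ _ sv E) /=; lia.
move=> [_ [b [_ [[u [v [su sv ->]]] bb [u' [v' [su' sv' ->]]] E]]]].
split=> //; exists v, b, u'; split=> //.
rewrite -catA in E; have E' := E; rewrite !catA in E'.
by rewrite E (starR _ _ su E) (starL _ _ sv' E') cats0.
Qed.

(** * Converse: extending the code by a word that ends with a left block *)

(* The word [u ++ x] ends with a left block, so it is not in the code, and by
   maximality it must overlap the code or itself; only the overlap [x] is
   possible. *)
Lemma maximal_extend u x : k < n ->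
  maximal_overlap_free n k (block_code n k lp rp) ->
  lp x -> size (u ++ x) = n ->
  (forall p, prefix p (u ++ x) -> size p <= k -> star lp p) ->
  (forall q, suffix q u -> size q < size u -> size q + size x <= k -> star rp q) ->
  prefix_in (block_code n k lp rp) x \/ prefix x (u ++ x).
Proof.
move=> kn [_ mx] lx un Hp Hs.
have [x0 xk] : 0 < size x /\ size x <= k by apply/andP/(block_size F); rewrite lx.
have lsx := star_block lx.
apply: contrapT => /not_orP[npre nbord].
apply: (mx (u ++ x)) => //.
  move=> Cw; have rx := code_suffix Cw (suffix_suffix u x) xk.
  by rewrite (star_disjoint F lsx rx) in x0.
apply/overlap_freeP; split.
  by move=> c [[]//|->].
move=> p c d /andP[p0 pk] Dc Dd pc pd.
have lsp : star lp p.
  by case: Dc => [/(code_prefix F)|Ew]; [apply|apply: Hp; rewrite -?Ew].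
suff /(star_disjoint F lsp) p_nil : star rp p by rewrite p_nil in p0.
case: Dd => [/code_suffix|Ew]; first exact.
(* A suffix of [u ++ x] is a suffix of [x] or has the form [q ++ x]. A proper suffix of [x] lies in
   the star of [rp]; [p = x] is excluded by assumption. *)
move: pd; rewrite Ew -prefix_rev rev_cat => /prefix_catP[|[q' Ep qu]].
  rewrite prefix_rev => px; have := size_suffix px; rewrite leq_eqVlt => /orP[/eqP s|s].
    have E : p = x.
      by apply: (can_inj revK); apply: prefix_size_eq; rewrite ?prefix_rev ?size_rev.
    by case: Dc => [Cc|Ec]; [case: npre; exists c; rewrite -?E|case: nbord; rewrite -Ec -E].
  by apply: (block_suffix _ px s); rewrite lx.
have {}Ep : p = rev q' ++ x by rewrite -[p]revK Ep rev_cat revK.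
have rq : star rp (rev q').
  apply: Hs; first by rewrite -prefix_rev revK.
    by move: pk un; rewrite Ep !size_cat; lia.
  by move: pk; rewrite Ep size_cat.
(* Here [p] is right blocks followed by [x], yet a product of left blocks, so the right part is
   empty and again [p = x]. *)
have q0 := star_rights_lefts F rq lsx; rewrite -Ep in q0.
case: nbord; move: Ep; rewrite (q0 lsp) /= => Ep.
case: Dc => [Cc|Ec]; first by case: npre; exists c; rewrite -?Ep.
by rewrite -Ec -Ep.
Qed.

(** A product that is a left block grows by a right letter at its end, a right block by a left
    letter in front. For [m = k] this gives a big block of the least length. *)
Lemma merge_of_size m : 0 < m <= k -> exists x y, [/\ lp x, rp y & size (x ++ y) = m.+1].
Proof.
have [l ll l1] := block_left F; have [r rr r1] := block_right F.
elim: m => // -[_ _|m IH /andP[_ mk]]; first by exists l, r; rewrite size_cat l1 r1.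
have [x [y [lx ry xy]]] := IH (ltnW mk).
have sxy : size (x ++ y) <= k by rewrite xy.
have /orP[lxy|rxy] := block_merge F lx ry sxy.
  by exists (x ++ y), r; rewrite size_cat xy r1 addn1.
by exists l, (x ++ y); rewrite size_cat xy l1.
Qed.

Lemma block_of_size m : 0 < m <= k -> exists2 x, lp x || rp x & size x = m.
Proof.
have [l ll l1] := block_left F; case: m => // -[_|m /andP[_ mk]].
  by exists l; rewrite ?ll.
have [x [y [lx ry xy]]] := @merge_of_size m.+1 (ltnW mk).
by exists (x ++ y) => //; apply: (block_merge F lx ry); rewrite xy.
Qed.

(** Induction on [k - size x], since one case passes to a longer left block. *)
Lemma maximal_left_prefix x : k < n <= 2 * k + 1 ->
  maximal_overlap_free n k (block_code n k lp rp) ->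
  (forall y, size y + size y = n -> 
     exists z, [/\ lp z || rp z, size z = size y & z <> y]) ->
  lp x -> prefix_in (block_code n k lp rp) x.
Proof.
move=> /andP[kn n2k] mx half.
have [m] := ubnP (k - size x); elim: m x => // m IH x xm lx.
have [x0 xk] : 0 < size x /\ size x <= k by apply/andP/(block_size F); rewrite lx.
have [nxk|nxk] := leqP (n - size x) k; last first.
  (* If [x] is a prefix of [u ++ x], then of the big block [y ++ z], which can be
     completed to a codeword by right blocks. *)
  have [|y [z [ly rz yz]]] := @merge_of_size k; first lia.
  have bb : big_block k lp rp (y ++ z) by split; [rewrite yz|exists y, z].
  have [r rr r1] := block_right F.
  have [v sv vn] := star_of_size (n - size x - k.+1) rr r1.
  have [v' sv' vn'] := star_of_size (size x) rr r1.
  have bvn : size ((y ++ z) ++ v) = n - size x by rewrite size_cat yz vn; lia.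
  case: (@maximal_extend ((y ++ z) ++ v) x) => //.
  - by rewrite size_cat bvn; lia.
  - move=> p; rewrite -catA => /prefix_catP[pb pk|[q -> _]].
      by apply: (big_prefix F bb pb); rewrite yz.
    by rewrite size_cat yz; lia.
  - by move=> q qs sq _; exact: big_star_suffix qs sq.
  rewrite -catA => /prefix_catP[xb|[q E _]]; last first.
    by move: xk; rewrite E size_cat yz; lia.
  exists ((y ++ z) ++ v ++ v'); last exact: prefix_catl.
  split; first by rewrite catA size_cat bvn vn'; lia.
  exists [::], (y ++ z), (v ++ v'); split=> //; first exact: star_nil.
  exact: star_cat.
(* Only for [size x = n / 2] can a block of length [n - size x] equal [x]; then [half] supplies
   another one. *)
have [y [bly yn yx]] : exists y, [/\ lp y || rp y, size y = n - size x & y <> x].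
  have [xx|xx] := eqVneq (size x + size x) n.
    by have [z [? sz ?]] := half x xx; exists z; split=> //; lia.
  have [|y bly yn] := @block_of_size (n - size x); first lia.
  exists y; split=> // E; move: xx; rewrite -{1}E yn; lia.
have [y0 yk] : 0 < size y /\ size y <= k by apply/andP/(block_size F).
(* If [y] is a right block, [x ++ y] is one big block of length [n], hence a codeword. *)
case/orP: (bly) => [ly|ry]; last first.
  exists (x ++ y); last exact: prefix_prefix.
  have xyn : size (x ++ y) = n by rewrite size_cat yn; lia.
  split=> //; exists [::], (x ++ y), [::]; rewrite cats0.
  split=> //; [exact: star_nil| |exact: star_nil].
  by split; [rewrite xyn|exists x, y].
case: (@maximal_extend y x) => //.
- by rewrite size_cat yn; lia.
- move=> p pyx _; apply: (star_prefix F) pyx.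
  exact: star_cat (star_block ly) (star_block lx).
- by move=> q qy sq _; exact: block_suffix qy sq.
(* If [x] is a prefix of [y], then [y] is longer and induction applies, or [x = y]. Otherwise
   [x = y ++ z], where [z] is both a prefix and a proper suffix of [x], hence empty by
   disjointness. *)
move=> /prefix_catP[xy|[z Ez zx]].
  have [sxy|sxy] := ltnP (size x) (size y).
    have [|c Cc yc] := IH y _ ly; first lia.
    by exists c => //; exact: prefix_trans xy yc.
  case: yx; rewrite (prefix_size_eq xy) //; apply/eqP.
  by rewrite eqn_leq sxy size_prefix.
have zs : size z < size x by rewrite Ez size_cat; lia.
have lz : star lp z := left_prefix F lx zx.
have rz : star rp z.
  by apply: block_suffix (zs); rewrite ?lx // Ez suffix_suffix.
by case: yx; rewrite Ez (star_disjoint F lz rz) cats0.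
Qed.

End FamilySuffix.

(** The code of the reversed family is the reversed code, and adding [w] to it amounts to adding
    [rev w] to the original. *)
Lemma maximal_rev n k lp rp :
  maximal_overlap_free n k (block_code n k lp rp) ->
  maximal_overlap_free n k (block_code n k (preim rev rp) (preim rev lp)).
Proof.
have Erev c : block_code n k (preim rev rp) (preim rev lp) (rev c) ->
    block_code n k lp rp c.
  move=> /block_code_rev; rewrite revK; congr (block_code n k _ _ c);
    by apply/funext => x /=; rewrite revK.
have E : block_code n k (preim rev rp) (preim rev lp) =
    rev @^-1` block_code n k lp rp.
  apply/seteqP; split=> c /=; first by rewrite -{1}[c]revK => /Erev.
  by move=> /block_code_rev; rewrite revK.
rewrite {}E => -[ovf mx]; split; first exact: overlap_free_rev.
move=> w wn nCw /overlap_free_rev ovw.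
apply: (mx (rev w)) => //; first by rewrite /words /= size_rev.
congr (overlap_free n k _): ovw; apply/seteqP; split=> c /= [].
- by rewrite revK; left.
- by move=> <-; rewrite revK; right.
- by left; rewrite revK.
- by move=> ->; right; rewrite revK.
Qed.

(** * From indexed sets to predicates on words *)

(** In a graded family the index is the length of the word, so one predicate encodes all the
    sets. *)
Definition blocks k (G : nat -> set (seq T)) : pred (seq T) :=
  fun x => `[< 0 < size x <= k /\ G (size x) x >].

Definition graded k (G : nat -> set (seq T)) :=
  forall i x, 0 < i <= k -> G i x -> size x = i.

Lemma blocksP k G i x : graded k G -> 0 < i <= k ->
  G i x <-> blocks k G x /\ size x = i.
Proof.
move=> gG ik; split=> [Gx|[/asboolP[_ Gx] <-] //].
have xi := gG i x ik Gx; split=> //; apply/asboolP.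
by rewrite xi.
Qed.

Lemma concats_star k G al x : graded k G -> all (fun a => 0 < a <= k) al ->
  concats G al x -> star (blocks k G) x /\ size x = sumn al.
Proof.
move=> gG; elim: al x => [|a al IH] x /=.
  by rewrite /concats big_nil => _ /= ->; split=> //; exact: star_nil.
rewrite /concats big_cons => /andP[ak alk] [y Gy [z Gz <-]].
have [yb ya] := (blocksP y gG ak).1 Gy; have [zb za] := IH z alk Gz.
by split; [exact: star_cat (star_block yb) zb|rewrite size_cat ya za].
Qed.

Lemma star_concats k G x : star (blocks k G) x ->
  exists al, [/\ all (leq 1) al, sumn al = size x & concats G al x].
Proof.
move=> [s + ->]; elim: s => [_|y s IH] /=.
  by exists [::]; split=> //; rewrite /concats big_nil.
move=> /andP[/asboolP[/andP[y0 _] Gy] /IH [al [al1 als Gal]]].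
exists (size y :: al); split=> /=; rewrite ?y0 ?size_cat ?als //.
by rewrite /concats big_cons; exists y => //; exists (flatten s).
Qed.

Lemma leq_sumn_mem (s : seq nat) a : a \in s -> a <= sumn s.
Proof.
elim: s => //= b s IH; rewrite in_cons => /orP[/eqP->|/IH]; lia.
Qed.

(** The parts of a composition of [n - s] are at most [n - k - 1 <= k], so all factors are blocks;
    conversely [s], [j], [al] and [i] are read off the lengths of the factors. *)
Lemma associated_codeE n k L R : k < n <= 2 * k + 1 -> graded k L -> graded k R ->
  associated_code n k L R = block_code n k (blocks k L) (blocks k R).
Proof.
move=> /andP[kn n2k] gL gR; apply/seteqP; split=> c.
  move=> [m /= /andP[km mn] [j /= /andP[mj jk] [al [al1 als] [i _]]]].
  move=> [u Lu [_ [_ [l Ll [r Rr <-]] [v Rv <-]] <-]].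
  have alk : all (fun a => 0 < a <= k) al.
    apply/allP => a aal; rewrite (allP al1 a aal) /=.
    by have := leq_sumn_mem aal; rewrite als; lia.
  move: alk als; rewrite -[in all _ al](cat_take_drop i al).
  rewrite -[in sumn al](cat_take_drop i al) all_cat sumn_cat => /andP[a1 a2] als.
  have [su us] := concats_star gL a1 Lu; have [sv vs] := concats_star gR a2 Rv.
  have [|] := (blocksP l gL _).1 Ll; first lia.
  move=> lb lj; have [|] := (blocksP r gR _).1 Rr; first lia.
  move=> rb rj; split; first by rewrite /= !size_cat us vs lj rj; lia.
  exists u, (l ++ r), v; split=> //; split; last by exists l, r.
  by rewrite size_cat lj rj; lia.
move=> [cn [u [b [v [su [kb [l [r [lb rb Eb]]]] sv E]]]]]; subst b.
have [al1 [al1_1 al1s Lu]] := star_concats su.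
have [al2 [al2_1 al2s Rv]] := star_concats sv.
have /asboolP[lk Ll] := lb; have /asboolP[rk Rr] := rb.
rewrite size_cat in kb.
have n_eq : size u + (size l + size r + size v) = n by rewrite -cn E !size_cat.
exists (size l + size r) => /=; first lia.
exists (size l) => /=; first lia.
exists (al1 ++ al2); first by split; [rewrite all_cat al1_1|rewrite sumn_cat; lia].
exists (size al1); first by rewrite /= size_cat; lia.
rewrite take_size_cat // drop_size_cat //; exists u => //.
exists ((l ++ r) ++ v); last by rewrite E.
exists (l ++ r); last by exists v.
by exists l => //; exists r => //; rewrite addKn.
Qed.

(** * Admissible families are block families *)

Section Admissible.
Variables (k : nat) (L R : nat -> set (seq T)).
Hypothesis adm : admissible k L R.

Lemma admissible_split i x : 1 < i <= k -> (L i `|` R i) x <->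
  exists j y z, [/\ 0 < j < i, L j y, R (i - j) z & x = y ++ z].
Proof.
case: adm => _ _ _ _ /(_ i) + ik => /(_ ik)[-> _]; split.
  by move=> [j /= ji [y Ly [z Rz <-]]]; exists j, y, z; split=> //; lia.
move=> [j [y [z [ji Ly Rz ->]]]]; exists j => /=; first lia.
by exists y => //; exists z.
Qed.

Lemma admissible_size i x : 0 < i <= k -> (L i `|` R i) x -> size x = i.
Proof.
have [m] := ubnP i; elim: m i x => // m IH i x im ik.
have [->|i1] := eqVneq i 1; first by case: adm => -> _ _ _ _.
move=> /admissible_split[|j [y [z [ji Ly Rz ->]]]]; first lia.
rewrite size_cat (IH j y) ?(IH (i - j) z); [lia|lia|lia|by right|lia|lia|by left].
Qed.

Lemma admissible_gradedl : graded k L.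
Proof. by move=> i x ik Lx; apply: admissible_size ik _; left. Qed.

Lemma admissible_gradedr : graded k R.
Proof. by move=> i x ik Rx; apply: admissible_size ik _; right. Qed.

Lemma admissible_blocks i x : 0 < i <= k ->
  (L i `|` R i) x <-> (blocks k L x || blocks k R x) /\ size x = i.
Proof.
move=> ik; split.
  move=> [Lx|Rx].
    by have [-> ->] := (blocksP x admissible_gradedl ik).1 Lx.
  by have [-> ->] := (blocksP x admissible_gradedr ik).1 Rx; rewrite orbT.
move=> [/orP[] bx xi]; [left|right].
  exact/(blocksP _ admissible_gradedl ik).
exact/(blocksP _ admissible_gradedr ik).
Qed.

Lemma blocks_size G x : blocks k G x -> 0 < size x <= k.
Proof. by move=> /asboolP[]. Qed.

Lemma admissible_family : 0 < k -> block_family k (blocks k L) (blocks k R).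
Proof.
move=> k0; case: (adm) => LR1 dis1 [l Ll] [r Rr] dis.
have szx x : blocks k L x || blocks k R x -> 0 < size x <= k.
  by case/orP => /blocks_size.
split=> //.
- move=> x /asboolP[xk Lx]; apply/asboolP => -[_ Rx].
  suff /disj_setPS/(_ x) : [disjoint L (size x) & R (size x)] by apply; split.
  have [-> //|x1] := eqVneq (size x) 1.
  by have [|_] := dis (size x); first lia.
- move=> x x1; have [|[//]] := (admissible_blocks x (k0 : 0 < 1 <= k)).1.
  by rewrite LR1.
- move=> x y Lx Ry xy; have xs := blocks_size Lx; have ys := blocks_size Ry.
  rewrite size_cat in xy.
  have xyk : 0 < size (x ++ y) <= k by rewrite size_cat; lia.
  have [|//] := (admissible_blocks (x ++ y) xyk).1.
  apply/admissible_split; first by rewrite size_cat; lia.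
  exists (size x), x, y; rewrite size_cat addKn; split=> //; first lia.
    by case/asboolP: Lx.
  by case/asboolP: Ry.
- move=> x bx; have xk := szx x bx.
  have [->|x1] := eqVneq (size x) 1; [by left|right].
  have /admissible_split[|j [y [z [ji Ly Rz E]]]] :=
      (admissible_blocks x xk).2 (conj bx erefl); first lia.
  exists y, z; split=> //.
    by apply: ((blocksP y admissible_gradedl _).1 Ly).1; lia.
  by apply: ((blocksP z admissible_gradedr _).1 Rz).1; lia.
- by have [] := (blocksP l admissible_gradedl (k0 : 0 < 1 <= k)).1 Ll; exists l.
- by have [] := (blocksP r admissible_gradedr (k0 : 0 < 1 <= k)).1 Rr; exists r.
Qed.

Lemma prefix_suffix_conditionE C : prefix_suffix_condition k L R C <->
  (forall x, blocks k L x -> prefix_in C x) /\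
  (forall x, blocks k R x -> suffix_in C x).
Proof.
split=> [P|[PL PR] t tk].
  by split=> x /asboolP[xk Gx]; have [PL PR] := P _ xk; [exact: PL|exact: PR].
split=> x Gx.
  exact: PL ((blocksP x admissible_gradedl tk).1 Gx).1.
exact: PR ((blocksP x admissible_gradedr tk).1 Gx).1.
Qed.

End Admissible.

Lemma card_ge2_neq (A : set (seq T)) y : `I_2 #<= A -> exists2 z, A z & z <> y.
Proof.
move=> A2; apply: contrapT => noz.
have /subset_card_le/(card_le_trans A2) : A `<=` [set y].
  by move=> z Az; apply: contrapT => zy; apply: noz; exists z.
by rewrite (card_le_eqr card_set1) card_le_II.
Qed.

End Blocks.

Theorem proposition7 (Sigma : finType) (n k : nat)
    (L R : nat -> set (seq Sigma)) :
  1 < #|Sigma| -> 2 <= n -> 1 <= k <= n - 1 -> n <= 2 * k + 1 ->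
  admissible k L R ->
  let C := associated_code n k L R in
  (prefix_suffix_condition k L R C -> maximal_overlap_free n k C) /\
  ((~~ odd n -> `I_2 #<= L n./2 `|` R n./2) ->
   maximal_overlap_free n k C -> prefix_suffix_condition k L R C).
Proof.
move=> _ n2 /andP[k0 kn1] n2k adm C; rewrite {}/C.
have kn : k < n <= 2 * k + 1 by lia.
have F := admissible_family adm k0.
have gL := admissible_gradedl adm; have gR := admissible_gradedr adm.
rewrite (associated_codeE kn gL gR) (prefix_suffix_conditionE adm).
split=> [[PL PR]|half mx]; first exact: block_code_maximal.
have half' y : size y + size y = n -> exists z,
    [/\ blocks k L z || blocks k R z, size z = size y & z <> y].
  move=> yn; have [|z LRz zy] := @card_ge2_neq _ (L n./2 `|` R n./2) y.
    by apply: half; rewrite -yn addnn odd_double.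
  move: LRz; rewrite -yn addnn doubleK.
  by move=> /(admissible_blocks adm)[|bz sz]; [lia|exists z].
split=> x bx; first exact: (maximal_left_prefix F kn mx half' bx).
(* A right block [x] becomes the left block [rev x] of the reversed family. *)
have [|//|c Cc xc] := maximal_left_prefix (block_family_rev F) kn (maximal_rev mx)
    _ (x := rev x).
- move=> y yn; have [|z [bz zs zy]] := half' (rev y); first by rewrite size_rev.
  exists (rev z); split; rewrite /= ?revK ?size_rev 1?orbC ?zs ?size_rev //.
  by move=> E; apply: zy; rewrite -E revK.
- by rewrite /= revK.
exists (rev c); last by rewrite -prefix_rev revK.
move: (block_code_rev Cc); congr (block_code n k _ _ _);
  by apply/funext => z /=; rewrite revK.
Qed.
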